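(* Let $\tau\in\mathrm{Aut}\,\mathcal{B}$. Then there exist $\mu,\nu\in\mathbb{F}^*$ and $\xi\in\{\pm1\}$ such that $$\tau(L_{\alpha,i})=\xi\,\mu^\alpha\nu^i\,L_{\xi(\alpha+i)-i,\,i}\quad\text{for all }\alpha\in\mathbb{Z},\ i\in\mathbb{Z}_+.$$ In particular, $\mathrm{Aut}\,\mathcal{B}\cong(\mathbb{F}^*\times\mathbb{F}^* )\rtimes\mathbb{Z}/2\mathbb{Z}$.
   Context: Let $\mathbb{F}$ be an algebraically closed field of characteristic zero, $\mathbb{F}^*=\mathbb{F}\setminus\{0\}$ and $\mathbb{Z}_+=\{0,1,2,\dots\}$. $\mathcal{B}$ is the Lie algebra over $\mathbb{F}$ with basis $\{L_{\alpha,i}\mid \alpha\in\mathbb{Z},\, i\in\mathbb{Z}_+\}$ and bracket $$[L_{\alpha,i},L_{\beta,j}]=\big((\alpha-1)(j+1)-(\beta-1)(i+1)\big)L_{\alpha+\beta,i+j}.$$ $\mathrm{Aut}\,\mathcal{B}$ is the group of Lie algebra automorphisms of $\mathcal{B}$ (bijective $\mathbb{F}$-linear maps preserving the bracket). For $\mu,\nu\in\mathbb{F}^*$ and $\xi\in\{\pm1\}$ the following linear maps are automorphisms of $\mathcal{B}$: $\varphi_\mu: L_{\alpha,i}\mapsto\mu^\alpha L_{\alpha,i}$; $\varphi'_\nu: L_{\alpha,i}\mapsto\nu^i L_{\alpha,i}$; $\rho_\xi: L_{\alpha,i}\mapsto\xi L_{\xi(\alpha+i)-i,i}$. The subgroups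 $\{\varphi_\mu\}\cong\mathbb{F}^*$, $\{\varphi'_\nu\}\cong\mathbb{F}^*$ and $\{\rho_\xi\}\cong\mathbb{Z}/2\mathbb{Z}$ are the ones corresponding to the factors $\mathbb{F}^*$, $\mathbb{F}^*$ and $\mathbb{Z}/2\mathbb{Z}$ in the semidirect product, with $\mathbb{Z}/2\mathbb{Z}$ acting by conjugation. *)

(* Defs.v *)
From HB Require Import structures.
From mathcomp Require Import all_boot all_order all_algebra all_fingroup.
From mathcomp Require Import ring boolp.
From mathcomp.finmap Require Import finmap.
From mathcomp.multinomials Require Import monalg.

Set Implicit Arguments.
Unset Strict Implicit.
Unset Printing Implicit Defensive.

Import GRing.Theory.
Local Open Scope ring_scope.

HB.mixin Record Lmodule_isLieAlgebra (F : fieldType) L of GRing.Lmodule F L := {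
  lie : L -> L -> L;
  lie_linearl : forall y : L, linear (fun x => lie x y);
  lie_linearr : forall x : L, linear (lie x);
  lie_alt : forall x : L, lie x x = 0;
  lie_jacobi : forall x y z : L,
    lie x (lie y z) + lie y (lie z x) + lie z (lie x y) = 0
}.

#[short(type="lieAlgType")]
HB.structure Definition LieAlgebra (F : fieldType) :=
  { L of GRing.Lmodule F L & Lmodule_isLieAlgebra F L }.

Section LieAut.
Variables (F : fieldType) (L : lieAlgType F).

Record lie_aut := LieAut {
  lie_aut_fun :> L -> L;
  lie_aut_linear : linear lie_aut_fun;
  lie_aut_lie : {morph lie_aut_fun : x y / lie x y};
  lie_aut_bij : bijective lie_aut_fun
}.

HB.instance Definition _ := gen_eqMixin lie_aut.
HB.instance Definition _ := gen_choiceMixin lie_aut.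

Lemma lie_autP (f g : lie_aut) : f =1 g -> f = g.
Proof.
case: f g => [f f1 f2 f3] [g g1 g2 g3] /= /funext eq_fg.
by move: f1 f2 f3; rewrite eq_fg => *; congr LieAut; exact: Prop_irrelevance.
Qed.

Fact id_linear : linear (@id L). Proof. by []. Qed.
Fact id_lie : {morph @id L : x y / lie x y}. Proof. by []. Qed.
Fact id_bij : bijective (@id L). Proof. by exists id. Qed.
Definition lie_aut_one := LieAut id_linear id_lie id_bij.

Fact comp_linear (f g : lie_aut) : linear (f \o g).
Proof. by move=> a x y; rewrite /= !lie_aut_linear. Qed.
Fact comp_lie (f g : lie_aut) : {morph f \o g : x y / lie x y}.
Proof. by move=> x y; rewrite /= !lie_aut_lie. Qed.
Definition lie_aut_mul (f g : lie_aut) :=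
  LieAut (comp_linear f g) (comp_lie f g)
    (bij_comp (lie_aut_bij f) (lie_aut_bij g)).

Lemma lie_aut_inv_ex (f : lie_aut) : exists g : L -> L, cancel f g /\ cancel g f.
Proof. by case: (lie_aut_bij f) => g fK gK; exists g. Qed.

Definition lie_aut_inv_fun (f : lie_aut) : L -> L :=
  projT1 (cid (lie_aut_inv_ex f)).
Lemma lie_aut_funK f : cancel (lie_aut_fun f) (lie_aut_inv_fun f).
Proof. by case: (projT2 (cid (lie_aut_inv_ex f))). Qed.
Lemma lie_aut_inv_funK f : cancel (lie_aut_inv_fun f) (lie_aut_fun f).
Proof. by case: (projT2 (cid (lie_aut_inv_ex f))). Qed.

Fact inv_linear f : linear (lie_aut_inv_fun f).
Proof.
move=> a x y; apply: (can_inj (lie_aut_funK f)).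
by rewrite lie_aut_linear !lie_aut_inv_funK.
Qed.
Fact inv_lie f : {morph lie_aut_inv_fun f : x y / lie x y}.
Proof.
move=> x y; apply: (can_inj (lie_aut_funK f)).
by rewrite lie_aut_lie !lie_aut_inv_funK.
Qed.
Fact inv_bij f : bijective (lie_aut_inv_fun f).
Proof. by exists f; [exact: lie_aut_inv_funK | exact: lie_aut_funK]. Qed.
Definition lie_aut_inv (f : lie_aut) :=
  LieAut (inv_linear f) (inv_lie f) (inv_bij f).

Fact lie_aut_mulA : associative lie_aut_mul.
Proof. by move=> f g h; apply: lie_autP. Qed.
Fact lie_aut_mul1 : left_id lie_aut_one lie_aut_mul.
Proof. by move=> f; apply: lie_autP. Qed.
Fact lie_aut_mulr1 : right_id lie_aut_one lie_aut_mul.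
Proof. by move=> f; apply: lie_autP. Qed.
Fact lie_aut_mulV : left_inverse lie_aut_one lie_aut_inv lie_aut_mul.
Proof.
by move=> f; apply: lie_autP; exact: lie_aut_funK.
Qed.
Fact lie_aut_mulrV : right_inverse lie_aut_one lie_aut_inv lie_aut_mul.
Proof.
by move=> f; apply: lie_autP; exact: lie_aut_inv_funK.
Qed.

HB.instance Definition _ := isGroup.Build lie_aut
  lie_aut_mulA lie_aut_mul1 lie_aut_mulr1 lie_aut_mulV lie_aut_mulrV.

Lemma lie_aut_mulE (f g : lie_aut) (x : L) : (f * g)%g x = f (g x).
Proof. by []. Qed.

End LieAut.

Section Fstar.
Variable F : fieldType.

Record fstar := Fstar { fstar_val :> F; fstar_neq0 : fstar_val != 0 }.

HB.instance Definition _ := [isSub for fstar_val].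
HB.instance Definition _ := [Choice of fstar by <:].

Definition fstar_one := Fstar (oner_neq0 F).
Definition fstar_mul (x y : fstar) :=
  Fstar (mulf_neq0 (fstar_neq0 x) (fstar_neq0 y)).
Fact fstar_inv_subproof (x : fstar) : (x : F)^-1 != 0.
Proof. by rewrite invr_eq0 fstar_neq0. Qed.
Definition fstar_inv (x : fstar) := Fstar (fstar_inv_subproof x).

Fact fstar_mulA : associative fstar_mul.
Proof. by move=> x y z; apply: val_inj; rewrite /= mulrA. Qed.
Fact fstar_mul1 : left_id fstar_one fstar_mul.
Proof. by move=> x; apply: val_inj; rewrite /= mul1r. Qed.
Fact fstar_mulr1 : right_id fstar_one fstar_mul.
Proof. by move=> x; apply: val_inj; rewrite /= mulr1. Qed.
Fact fstar_mulV : left_inverse fstar_one fstar_inv fstar_mul.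
Proof. by move=> x; apply: val_inj; rewrite /= mulVf ?fstar_neq0. Qed.
Fact fstar_mulrV : right_inverse fstar_one fstar_inv fstar_mul.
Proof. by move=> x; apply: val_inj; rewrite /= mulfV ?fstar_neq0. Qed.

HB.instance Definition _ := isGroup.Build fstar
  fstar_mulA fstar_mul1 fstar_mulr1 fstar_mulV fstar_mulrV.

End Fstar.

Section SemidirectProduct.
Local Open Scope group_scope.
Variables N H : groupType.

Record group_autact := AutAction {
  aut_act :> H -> N -> N;
  aut_act1 : forall n, aut_act 1 n = n;
  aut_actM : forall h k n, aut_act (h * k) n = aut_act h (aut_act k n);
  aut_act_morph : forall h, {morph aut_act h : m n / m * n}
}.

(* The parameter theta is phantom: it selects the group law on pairs. *)
Record semidirect (theta : group_autact) := Semidirect { sd_pair : N * H }.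

Variable theta : group_autact.

HB.instance Definition _ := [isNew for @sd_pair theta].
HB.instance Definition _ := [Choice of semidirect theta by <:].

Definition sd_elt (n : N) (h : H) : semidirect theta := Semidirect theta (n, h).

Definition sd_one := sd_elt 1 1.
Definition sd_mul (x y : semidirect theta) :=
  let: Semidirect (n, h) := x in let: Semidirect (m, k) := y in
  sd_elt (n * theta h m) (h * k).
Definition sd_inv (x : semidirect theta) :=
  let: Semidirect (n, h) := x in sd_elt (theta h^-1 n^-1) h^-1.

Lemma aut_act_1 h : theta h 1 = 1.
Proof.
by apply: (@mulgI _ (theta h 1)); rewrite -aut_act_morph !mulg1.
Qed.

Fact sd_mulA : associative sd_mul.
Proof.
move=> [[n h]] [[m k]] [[p l]].
by rewrite /= /sd_elt aut_act_morph aut_actM !mulgA.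
Qed.
Fact sd_mul1 : left_id sd_one sd_mul.
Proof. by move=> [[n h]]; rewrite /= /sd_elt aut_act1 !mul1g. Qed.
Fact sd_mulr1 : right_id sd_one sd_mul.
Proof. by move=> [[n h]]; rewrite /= /sd_elt aut_act_1 !mulg1. Qed.
Fact sd_mulV : left_inverse sd_one sd_inv sd_mul.
Proof.
move=> [[n h]].
by rewrite /= /sd_elt -aut_act_morph !mulVg aut_act_1.
Qed.
Fact sd_mulrV : right_inverse sd_one sd_inv sd_mul.
Proof.
move=> [[n h]].
by rewrite /= /sd_elt -aut_actM mulgV aut_act1 mulgV.
Qed.

HB.instance Definition _ := isGroup.Build (semidirect theta)
  sd_mulA sd_mul1 sd_mulr1 sd_mulV sd_mulrV.

End SemidirectProduct.

Section LinExt.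
Variables (F : fieldType) (K : choiceType) (V : lmodType F).
Implicit Types (f : K -> V) (x : {malg F[K]}).

Definition lin_ext f x : V := \sum_(k <- msupp x) x@_k *: f k.

Lemma lin_extw f x (d : {fset K}) : (msupp x `<=` d)%fset ->
  lin_ext f x = \sum_(k <- d) x@_k *: f k.
Proof.
move=> le_d; apply: big_fset_incl => // k _ /mcoeff_outdom ->.
by rewrite scale0r.
Qed.

Lemma lin_ext_linear f : linear (lin_ext f).
Proof.
move=> a x y; pose d := (msupp (a *: x + y) `|` (msupp x `|` msupp y))%fset.
have [dxy dx dy] : [/\ msupp (a *: x + y) `<=` d,
    msupp x `<=` d & msupp y `<=` d]%fset.
  split; first exact: fsubsetUl.
    by apply: fsubsetU; rewrite fsubsetUl orbT.
  by apply: fsubsetU; rewrite fsubsetUr orbT.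
rewrite (lin_extw _ dxy) (lin_extw _ dx) (lin_extw _ dy).
rewrite scaler_sumr -big_split /=; apply: eq_bigr => k _.
by rewrite mcoeffD mcoeffZ scalerDl scalerA.
Qed.

Lemma lin_extU f k : lin_ext f << k >> = f k.
Proof. by rewrite (lin_extw _ msuppU_le) big_seq_fset1 mcoeffUU scale1r. Qed.

Lemma malg_lin_ext x : x = \sum_(k <- msupp x) x@_k *: << k >>.
Proof.
rewrite {1}[x]monalgE; apply: eq_bigr => k _.
by apply/malgP => j; rewrite mcoeffZ !mcoeffU mulrnAr mulr1.
Qed.

Lemma lin_ext_uniq (g h : {malg F[K]} -> V) : linear g -> linear h ->
  (forall k, g << k >> = h << k >>) -> g =1 h.
Proof.
move=> gL hL eq_gh x.
pose g' := HB.pack_for {linear {malg F[K]} -> V} g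
  (GRing.isLinear.Build _ _ _ _ g gL).
pose h' := HB.pack_for {linear {malg F[K]} -> V} h
  (GRing.isLinear.Build _ _ _ _ h hL).
rewrite -[g]/(g' : _ -> _) -[h]/(h' : _ -> _) [x]malg_lin_ext !linear_sum.
by apply: eq_bigr => k _; rewrite !linearZ /=; congr (_ *: _); exact: eq_gh.
Qed.

End LinExt.

(* The element g@_(alpha, i) is the coefficient of L_{alpha, i} in g, so the
   elements of blockB are the finite linear combinations of the L_{alpha, i}. *)
Definition blockB (F : fieldType) := {malg F[(int * nat)%type]}.

HB.instance Definition _ (F : fieldType) := GRing.Lmodule.copy (blockB F) {malg F[(int * nat)%type]}.

Definition basisL (F : fieldType) (alpha : int) (i : nat) : blockB F :=
  << (alpha, i) >>.
Arguments basisL {F} alpha i.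

Section BlockB.
Variable F : fieldType.
Local Notation B := (blockB F).
Local Notation L := (@basisL F).

Definition bracket_coef (a b : int * nat) : int :=
  (a.1 - 1) * (b.2%:Z + 1) - (b.1 - 1) * (a.2%:Z + 1).

Definition bracket (x y : B) : B :=
  lin_ext (fun a => lin_ext (fun b =>
    (bracket_coef a b)%:~R *: L (a.1 + b.1) (a.2 + b.2)%N) y) x.

Lemma bracketL alpha i beta j : bracket (L alpha i) (L beta j) =
  ((alpha - 1) * (j%:Z + 1) - (beta - 1) * (i%:Z + 1))%:~R
    *: L (alpha + beta) (i + j)%N.
Proof. by rewrite /bracket !lin_extU. Qed.

Fact bracket_linearl y : linear (fun x => bracket x y).
Proof. exact: lin_ext_linear. Qed.

Fact bracket_linearr x : linear (bracket x).
Proof.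
move=> a y z; rewrite /bracket /lin_ext scaler_sumr -big_split /=.
apply: eq_bigr => k _; rewrite scalerA mulrC -scalerA -scalerDr.
by congr (_ *: _); exact: lin_ext_linear.
Qed.

Fact bracket_coefC a b : bracket_coef a b = - bracket_coef b a.
Proof. by rewrite /bracket_coef; ring. Qed.

Fact bracket_alt_basis (a b : int * nat) :
  (bracket_coef a b)%:~R *: L (a.1 + b.1) (a.2 + b.2)%N =
  - ((bracket_coef b a)%:~R *: L (b.1 + a.1) (b.2 + a.2)%N).
Proof.
by rewrite bracket_coefC rmorphN scaleNr [b.1 + a.1]addrC [(b.2 + a.2)%N]addnC.
Qed.

Fact sum_alt (I : Type) (V : zmodType) (T : I -> I -> V) (s : seq I) :
  (forall a, T a a = 0) -> (forall a b, T a b = - T b a) ->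
  \sum_(a <- s) \sum_(b <- s) T a b = 0.
Proof.
move=> T0 TN; elim: s => [|k s IHs]; first by rewrite big_nil.
rewrite big_cons big_cons T0 add0r.
under [X in _ + X]eq_bigr do rewrite big_cons.
rewrite big_split /= IHs addr0 -big_split big1 //= => a _.
by rewrite TN addNr.
Qed.

Fact bracket_alt x : bracket x x = 0.
Proof.
pose T a b : B := x@_a *: (x@_b *:
  ((bracket_coef a b)%:~R *: L (a.1 + b.1) (a.2 + b.2)%N)).
transitivity (\sum_(a <- msupp x) \sum_(b <- msupp x) T a b).
  by apply: eq_bigr => a _; rewrite /lin_ext scaler_sumr.
apply: sum_alt => [a|a b]; rewrite /T.
  by rewrite /bracket_coef subrr scale0r !scaler0.
by rewrite bracket_alt_basis !scalerN !scalerA [x@_a * _]mulrC.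
Qed.

Let linZ (h : B -> B) : linear h -> forall a x, h (a *: x) = a *: h x.
Proof.
move=> hL a x; have h0 : h 0 = 0.
  by have := hL (-1) 0 0; rewrite scaler0 addr0 scaleN1r addNr.
by rewrite -[a *: x]addr0 hL h0 addr0.
Qed.

Let bracketZr u c v : bracket u (c *: v) = c *: bracket u v.
Proof. exact: linZ (bracket_linearr u) c v. Qed.

Let bracketZl u c v : bracket (c *: v) u = c *: bracket v u.
Proof. exact: linZ (bracket_linearl u) c v. Qed.

Let bracketLL al i be j ga k :
  bracket (L al i) (bracket (L be j) (L ga k)) =
  (((be - 1) * (k%:Z + 1) - (ga - 1) * (j%:Z + 1)) *
   ((al - 1) * ((j + k)%N%:Z + 1) - (be + ga - 1) * (i%:Z + 1)))%:~R
  *: L (al + (be + ga)) (i + (j + k))%N.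
Proof.
rewrite (bracketL be j ga k) bracketZr (bracketL al i (be + ga) (j + k)%N).
by rewrite scalerA intrM.
Qed.

Fact bracket_jacobi_basis (al be ga : int) (i j k : nat) :
  bracket (L al i) (bracket (L be j) (L ga k)) +
  bracket (L be j) (bracket (L ga k) (L al i)) +
  bracket (L ga k) (bracket (L al i) (L be j)) = 0.
Proof.
rewrite !bracketLL.
have -> : be + (ga + al) = al + (be + ga) by ring.
have -> : ga + (al + be) = al + (be + ga) by ring.
have -> : (j + (k + i) = i + (j + k))%N by rewrite addnA addnC.
have -> : (k + (i + j) = i + (j + k))%N by rewrite addnCA [(k + j)%N]addnC.
rewrite -!scalerDl -!intrD !PoszD.
set c : int := (X in X%:~R); have -> : c = 0 by rewrite /c; ring.
by rewrite scale0r.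
Qed.

Fact bracket_jacobi x y z :
  bracket x (bracket y z) + bracket y (bracket z x) + bracket z (bracket x y)
    = 0.
Proof.
have lD (f g : B -> B) : linear f -> linear g -> linear (fun x => f x + g x).
  by move=> fL gL a u v; rewrite fL gL scalerDr addrACA.
have lC (f g : B -> B) : linear f -> linear g -> linear (fun x => f (g x)).
  by move=> fL gL a u v; rewrite gL fL.
have l0 : linear (fun _ : B => 0 : B) by move=> a u v; rewrite scaler0 addr0.
have ll := bracket_linearl; have lr := bracket_linearr.
move: x; apply: lin_ext_uniq => // [|a].
  apply: (lD (fun x => bracket x _ + bracket y (bracket z x))
             (fun x => bracket z (bracket x y))); last exact: lC.
  by apply: lD => //; exact: lC.
move: y; apply: lin_ext_uniq => // [|b].
  apply: (lD (fun y => bracket _ (bracket y z) + bracket y _)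
             (fun y => bracket z (bracket _ y))); last exact: lC.
  by apply: lD => //; exact: lC (lr _) (ll _).
move: z; apply: lin_ext_uniq => // [|c].
  apply: (lD (fun z => bracket _ (bracket _ z) + bracket _ (bracket z _))
             (fun z => bracket z _)); last exact: ll.
  by apply: lD => //; [exact: lC (lr _) (lr _)|exact: lC (lr _) (ll _)].
case: a b c => [al i] [be j] [ga k]; exact: bracket_jacobi_basis.
Qed.

HB.instance Definition _ := Lmodule_isLieAlgebra.Build F B
  bracket_linearl bracket_linearr bracket_alt bracket_jacobi.

Lemma lieL alpha i beta j : lie (L alpha i) (L beta j) =
  ((alpha - 1) * (j%:Z + 1) - (beta - 1) * (i%:Z + 1))%:~R
    *: L (alpha + beta) (i + j)%N.
Proof. exact: bracketL. Qed.

Section Monomial.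
Variables (c d : int -> nat -> F) (s t : int -> nat -> int).
Let f : B -> B := lin_ext (fun a => c a.1 a.2 *: L (s a.1 a.2) a.2).
Let g : B -> B := lin_ext (fun a => d a.1 a.2 *: L (t a.1 a.2) a.2).

Hypothesis ts : forall a i, t (s a i) i = a.
Hypothesis st : forall a i, s (t a i) i = a.
Hypothesis cd : forall a i, c a i * d (s a i) i = 1.
Hypothesis dc : forall a i, d a i * c (t a i) i = 1.
Hypothesis sD : forall a b i j, s (a + b) (i + j)%N = s a i + s b j.
Hypothesis cD : forall a b i j,
  (bracket_coef (a, i) (b, j))%:~R * c (a + b) (i + j)%N =
  c a i * c b j * (bracket_coef (s a i, i) (s b j, j))%:~R.

Let fL : linear f. Proof. exact: lin_ext_linear. Qed.
Let gL : linear g. Proof. exact: lin_ext_linear. Qed.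

Let fE a i : f (L a i) = c a i *: L (s a i) i.
Proof. exact: lin_extU. Qed.

Let gE a i : g (L a i) = d a i *: L (t a i) i.
Proof. exact: lin_extU. Qed.

Let monomial_lieL al i be j :
  f (bracket (L al i) (L be j)) = bracket (f (L al i)) (f (L be j)).
Proof.
rewrite (bracketL al i be j) (linZ fL) (fE al i) (fE be j) (fE (al + be)).
rewrite bracketZr bracketZl (bracketL (s al i) i (s be j) j) !scalerA sD.
by rewrite [in LHS](cD al be i j) [c be j * c al i]mulrC.
Qed.

Fact monomial_aut_lie : {morph f : x y / lie x y}.
Proof.
move=> x y.
have lC (h k : B -> B) : linear h -> linear k -> linear (fun x => h (k x)).
  by move=> hL kL a u v; rewrite kL hL.
move: x; apply: lin_ext_uniq; [exact: lC (fL) (bracket_linearl _)|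
  exact: (lC (fun x => bracket x _)) (bracket_linearl _) fL|].
move=> a; move: y; apply: lin_ext_uniq; [exact: lC (fL) (bracket_linearr _)|
  exact: lC (bracket_linearr _) fL|].
by case: a => [al i] [be j]; exact: monomial_lieL.
Qed.

Fact monomial_aut_bij : bijective f.
Proof.
have idL : linear (fun x : B => x) by [].
have gfL : linear (fun x => g (f x)) by move=> a u v; rewrite fL gL.
have fgL : linear (fun x => f (g x)) by move=> a u v; rewrite gL fL.
exists g; [apply: (lin_ext_uniq gfL idL)|apply: (lin_ext_uniq fgL idL)].
  move=> [a i]; rewrite -/(L a i) (fE a i) (linZ gL) (gE (s a i)).
  by rewrite scalerA cd ts scale1r.
move=> [a i]; rewrite -/(L a i) (gE a i) (linZ fL) (fE (t a i)).
by rewrite scalerA dc st scale1r.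
Qed.

End Monomial.

Definition phi_fun (mu : F) : B -> B :=
  lin_ext (fun a => mu ^ a.1 *: L a.1 a.2).

Fact phi_lie (mu : fstar F) : {morph phi_fun mu : x y / lie x y}.
Proof.
apply: (monomial_aut_lie (c := fun a _ => (mu : F) ^ a) (s := fun a _ => a))
  => // a b i j.
by rewrite expfzDr ?fstar_neq0 // mulrC.
Qed.

Fact phi_bij (mu : fstar F) : bijective (phi_fun mu).
Proof.
have m0 := fstar_neq0 mu.
apply: (monomial_aut_bij (c := fun a _ => _ ^ a) (s := fun a _ => a)
    (d := fun a _ => (mu : F) ^ (- a)) (t := fun a _ => a)) => // a _.
  by rewrite -expfzDr // addrN.
by rewrite -expfzDr // addNr.
Qed.

Definition phi (mu : fstar F) : lie_aut B :=
  LieAut (L := B) (lin_ext_linear _) (phi_lie mu) (phi_bij mu).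

Lemma phiL (mu : fstar F) alpha i :
  phi mu (L alpha i) = (mu : F) ^ alpha *: L alpha i.
Proof. exact: lin_extU. Qed.

Definition phi'_fun (nu : F) : B -> B :=
  lin_ext (fun a => nu ^+ a.2 *: L a.1 a.2).

Fact phi'_lie (nu : fstar F) : {morph phi'_fun nu : x y / lie x y}.
Proof.
apply: (monomial_aut_lie (c := fun _ i => (nu : F) ^+ i) (s := fun a _ => a))
  => // a b i j.
by rewrite exprD mulrC.
Qed.

Fact phi'_bij (nu : fstar F) : bijective (phi'_fun nu).
Proof.
have n0 := fstar_neq0 nu.
apply: (monomial_aut_bij (c := fun _ i => _ ^+ i) (s := fun a _ => a)
    (d := fun _ i => (nu : F) ^- i) (t := fun a _ => a)) => // _ i.
  by rewrite mulfV // expf_neq0.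
by rewrite mulVf // expf_neq0.
Qed.

Definition phi' (nu : fstar F) : lie_aut B :=
  LieAut (L := B) (lin_ext_linear _) (phi'_lie nu) (phi'_bij nu).

Lemma phi'L (nu : fstar F) alpha i :
  phi' nu (L alpha i) = (nu : F) ^+ i *: L alpha i.
Proof. exact: lin_extU. Qed.

(* The sign xi attached to a class k of Z/2Z is (-1)^k. *)
Definition sign2 (k : 'Z_2) : int := (-1) ^+ (k : nat).

Lemma sign2P (k : 'Z_2) : sign2 k = 1 \/ sign2 k = -1.
Proof. by rewrite /sign2 -signr_odd; case: (odd _); [right|left]. Qed.

Definition rho_fun (xi : int) : B -> B :=
  lin_ext (fun a => xi%:~R *: L (xi * (a.1 + a.2%:Z) - a.2%:Z) a.2).

Fact rho_lie (k : 'Z_2) : {morph rho_fun (sign2 k) : x y / lie x y}.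
Proof.
apply: (monomial_aut_lie (c := fun _ _ => (sign2 k)%:~R)
    (s := fun a i => sign2 k * (a + i%:Z) - i%:Z)) => [a b i j|a b i j].
  by rewrite PoszD; ring.
by rewrite -!rmorphM; congr (_%:~R); rewrite /bracket_coef /=;
  case: (sign2P k) => ->; ring.
Qed.

Fact rho_bij (k : 'Z_2) : bijective (rho_fun (sign2 k)).
Proof.
apply: (monomial_aut_bij (c := fun _ _ => (sign2 k)%:~R)
    (s := fun a i => sign2 k * (a + i%:Z) - i%:Z)
    (d := fun _ _ => (sign2 k)%:~R)
    (t := fun a i => sign2 k * (a + i%:Z) - i%:Z)) => a i;
  by rewrite -?rmorphM; case: (sign2P k) => ->; rewrite ?mulrNN ?mulr1; ring.
Qed.

Definition rho (k : 'Z_2) : lie_aut B :=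
  LieAut (L := B) (lin_ext_linear _) (rho_lie k) (rho_bij k).

Lemma rhoL (k : 'Z_2) alpha i : rho k (L alpha i) =
  (sign2 k)%:~R *: L (sign2 k * (alpha + i%:Z) - i%:Z) i.
Proof. exact: lin_extU. Qed.

Lemma lie_aut_basisP (f g : lie_aut B) :
  (forall alpha i, f (L alpha i) = g (L alpha i)) -> f = g.
Proof.
move=> eq_fg; apply: lie_autP.
apply: (lin_ext_uniq (@lie_aut_linear F B f) (@lie_aut_linear F B g)) => -[a i].
exact: eq_fg.
Qed.

End BlockB.

Arguments phi {F} mu.
Arguments phi' {F} nu.
Arguments rho {F} k.

(* Main.v *)
Require Import Defs.
From HB Require Import structures.
From mathcomp Require Import all_boot all_order all_algebra all_fingroup.
From mathcomp Require Import ring zify.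
From mathcomp.finmap Require Import finmap.
From mathcomp.multinomials Require Import monalg.
From mathcomp Require boolp.

(** Put t = L_{0,0}.  Since [t, L_{alpha,i}] = -(alpha + i) L_{alpha,i}, ad t is
    diagonalizable with integer eigenvalues.  Conversely an element x having a
    basis element other than t in its support is not ad-locally finite: for a
    suitable lexicographic order its leading exponent a is positive, and there
    is a basis element L_b such that every product of operators ad x - c maps
    L_b to an element with leading exponent b + n a.  Hence an automorphism
    tau maps t to a multiple of t, and comparing eigenvalues (also for the
    inverse) tau t = t or tau t = -t; composing with rho we may assume
    tau t = t.

    Then tau preserves the eigenspaces W_k = <L_{k-i,i} | i>, k in Z, which we
    identify with F[X] through L_{k-i,i} |-> X^i.  The bracket of p in W_0 and
    q in W_k is -k (X p)' q in W_k, so for nonzero k tau acts on W_k as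
    q |-> (q o r) c_k, where r is half of (X tau(X))' computed in W_0.
    Surjectivity forces c_k to be a nonzero scalar and r = a X + b with a
    nonzero; [L_{1,0}, L_{-2,1}] = 3 L_{-1,1} gives b = 0, and
    [L_{k,0}, L_{l,0}] = (k - l) L_{k+l,0} gives c_k = c_1^k.  Thus
    tau L_{alpha,i} = c_1^(alpha+i) a^i L_{alpha,i}. *)
Set Implicit Arguments.
Unset Strict Implicit.
Unset Printing Implicit Defensive.

Import GRing.Theory.
Local Open Scope ring_scope.

HB.instance Definition _ (F : fieldType) (L : lieAlgType F) (f : lie_aut L) :=
  GRing.isLinear.Build F L L _ f (@lie_aut_linear F L f).

HB.instance Definition _ (F : fieldType) (L : lieAlgType F) (x : L) :=
  GRing.isLinear.Build F L L _ (lie x) (lie_linearr x).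

(** The recursion breaks only at k = l = 1; there C(2) C(-1) = C(1), and C(-1) is cancelled. *)
Lemma exprz_of_morph (F : fieldType) (C : int -> F) : C 0 = 1 ->
    (forall k, C k != 0) -> (forall k l, k != l -> C (k + l) = C k * C l) ->
  forall k, C k = C 1 ^ k.
Proof.
move=> C0 C_neq0 CD.
have CN : C (-1) * C 1 = 1 by rewrite -CD // addNr C0.
have CS l : C (l + 1) = C l * C 1.
  have [-> | l1] := eqVneq l 1; last exact: CD.
  apply: (mulIf (C_neq0 (-1))); rewrite -mulrA [C 1 * C _]mulrC CN mulr1.
  by rewrite -CD.
elim=> [|n IHn|n IHn]; first by rewrite C0.
  by rewrite -addn1 PoszD CS IHn exprzD_nat expr1z.
apply: (mulIf (C_neq0 1)); rewrite -CS.
have -> : - n.+1%:Z + 1 = - n%:Z by lia.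
rewrite IHn -{3}[C 1]expr1z -expfzDr //.
by congr (_ ^ _); lia.
Qed.

(** * Products of operators ad x - c *)

Section LieAlgebra.
Variables (F : fieldType) (L : lieAlgType F).
Implicit Types (x y z : L) (c : F).

Lemma lieZl c x y : lie (c *: x) y = c *: lie x y.
Proof.
have l0 : lie 0 y = 0.
  by have := lie_linearl y (-1) 0 0; rewrite scaler0 addr0 scaleN1r addNr.
by have := lie_linearl y c x 0; rewrite !addr0 l0 addr0.
Qed.

Lemma lieZr c x y : lie x (c *: y) = c *: lie x y.
Proof. exact: linearZ. Qed.

Lemma lie_autZ (f : lie_aut L) c x : f (c *: x) = c *: f x.
Proof. exact: linearZ. Qed.

Lemma lie_suml (I : Type) (r : seq I) (f : I -> L) y :
  lie (\sum_(i <- r) f i) y = \sum_(i <- r) lie (f i) y.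
Proof.
elim: r => [|i r IHr].
  by rewrite !big_nil -[X in lie X _](scale0r 0) lieZl scale0r.
by rewrite !big_cons -IHr -[f i]scale1r lie_linearl !scale1r.
Qed.

Definition ad_sub x y c : L := lie x y - c *: y.

Lemma ad_subs_aut (f : lie_aut L) x y s :
  f (foldl (ad_sub x) y s) = foldl (ad_sub (f x)) (f y) s.
Proof.
elim: s y => //= c s IHs y; rewrite IHs; congr foldl.
by rewrite /ad_sub linearB linearZ /= lie_aut_lie.
Qed.

End LieAlgebra.

(* s = 1 gives the lexicographic order on exponents, s = -1 its opposite. *)
Definition lexle (s : int) (a b : int * nat) : bool :=
  (s * a.1 < s * b.1) || (a.1 == b.1) && (s * a.2%:Z <= s * b.2%:Z).

(** * Lexicographic orders on exponents *)

Section LexOrder.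
Variable s : int.
Hypothesis sE : s = 1 \/ s = -1.
Implicit Types a b c : int * nat.

Definition addk a b : int * nat := (a.1 + b.1, (a.2 + b.2)%N).

Lemma lexle_refl a : lexle s a a.
Proof. by rewrite /lexle; case: sE => ->; lia. Qed.

Lemma lexle_total a b : lexle s a b || lexle s b a.
Proof. by rewrite /lexle; case: sE => ->; lia. Qed.

Lemma lexle_trans b a c : lexle s a b -> lexle s b c -> lexle s a c.
Proof. by rewrite /lexle; case: sE => ->; lia. Qed.

Lemma lexle_anti a b : lexle s a b -> lexle s b a -> a = b.
Proof.
case: a b => [a1 a2] [b1 b2]; rewrite /lexle /= => ab ba.
suff [-> ->] : a1 = b1 /\ a2 = b2 by [].
by case: sE ab ba => ->; lia.
Qed.

Lemma lexle_add a a' b b' :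
  lexle s a a' -> lexle s b b' -> lexle s (addk a b) (addk a' b').
Proof. by rewrite /lexle /addk /=; case: sE => ->; lia. Qed.

(** Strict monotonicity of addition: only the two leading exponents can contribute to the top
    exponent of a bracket. *)
Lemma lexle_add_inj a a' b b' : lexle s a a' -> lexle s b b' ->
  addk a b = addk a' b' -> a = a' /\ b = b'.
Proof.
move=> aa' bb' [eq1 eq2].
suff: lexle s a' a && lexle s b' b.
  by case/andP=> a'a b'b; split; apply: lexle_anti.
by move: aa' bb' eq1 eq2; rewrite /lexle; case: sE => ->; lia.
Qed.

Lemma lexle_max (r : seq (int * nat)) a : a \in r ->
  exists2 m, m \in r & forall b, b \in r -> lexle s b m.
Proof.
elim: r a => // a [|c r] IHr _ _.
  by exists a => [|b]; rewrite inE // => /eqP->; apply: lexle_refl.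
have [m mr max_m] := IHr c (mem_head _ _).
have [am | ma] := orP (lexle_total a m).
  by exists m => [|b]; rewrite inE ?mr ?orbT // => /predU1P[-> // | /max_m].
exists a => [|b]; first exact: mem_head.
rewrite inE => /predU1P[-> | /max_m bm]; first exact: lexle_refl.
exact: lexle_trans bm ma.
Qed.

End LexOrder.

(** * Lie algebras with a basis satisfying the relations of B *)

(* The basis is abstract because unification on the concrete type blockB unfolds
   finitely supported functions and becomes intractable. *)
Section BlockBasis.
Variables (F : fieldType) (B : lieAlgType F).
Variables (L : int -> nat -> B) (supp : B -> seq (int * nat)).
Variables (coefL : int * nat -> B -> F).
Variables (polyB : {linear B -> {poly F}}).
Hypothesis lieLE : forall alpha i beta j, lie (L alpha i) (L beta j) =
  (bracket_coef (alpha, i) (beta, j))%:~R *: L (alpha + beta) (i + j)%N.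
Hypothesis coefL_linear : forall a, linear (coefL a : B -> F^o).
Hypothesis supp_uniq : forall x, uniq (supp x).
Hypothesis mem_supp : forall a x, (a \in supp x) = (coefL a x != 0).
Hypothesis suppE : forall x, x = \sum_(a <- supp x) coefL a x *: L a.1 a.2.
Hypothesis coefL_basis :
  forall alpha i b, coefL b (L alpha i) = (b == (alpha, i))%:R.
Hypothesis polyBL : forall alpha i, polyB (L alpha i) = 'X^i.
Implicit Types (x y : B) (a b : int * nat).

(** * Coordinates in the basis *)

Lemma coefLP x y : (forall a, coefL a x = coefL a y) -> x = y.
Proof.
move=> eq_xy; have supp_xy : perm_eq (supp x) (supp y).
  by apply: uniq_perm => // a; rewrite !mem_supp eq_xy.
rewrite [x]suppE [y]suppE (perm_big _ supp_xy) /=.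
by apply: eq_bigr => a _; rewrite eq_xy.
Qed.

Lemma coefL_sum a (I : Type) (r : seq I) (f : I -> B) :
  coefL a (\sum_(i <- r) f i) = \sum_(i <- r) coefL a (f i).
Proof.
pose g := HB.pack_for {linear B -> F^o} (coefL a)
  (GRing.isLinear.Build _ _ _ _ _ (coefL_linear a)).
exact: (linear_sum g).
Qed.

Lemma coefL0 a : coefL a 0 = 0.
Proof. by have := coefL_sum a [::] (fun i : nat => 0); rewrite !big_nil. Qed.

Lemma coefLZ a c x : coefL a (c *: x) = c * coefL a x.
Proof. by have := coefL_linear a c x 0; rewrite coefL0 !addr0. Qed.

Lemma coefLD a x y : coefL a (x + y) = coefL a x + coefL a y.
Proof. by have := coefL_linear a 1 x y; rewrite !scale1r. Qed.

Lemma coefL_ad_sub a x y c :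
  coefL a (ad_sub x y c) = coefL a (lie x y) - c * coefL a y.
Proof. by rewrite coefLD -scaleNr coefLZ mulNr. Qed.

Lemma scaleL_inj alpha i : injective (fun c => c *: L alpha i).
Proof.
move=> c d /(congr1 (coefL (alpha, i))).
by rewrite !coefLZ coefL_basis eqxx !mulr1.
Qed.

Lemma lieL_eq alpha i beta j gamma k (c : int) :
    bracket_coef (alpha, i) (beta, j) = c -> alpha + beta = gamma ->
    (i + j)%N = k ->
  lie (L alpha i) (L beta j) = c%:~R *: L gamma k.
Proof. by rewrite lieLE => -> -> ->. Qed.

Lemma L_neq0 alpha i : L alpha i != 0.
Proof.
apply/eqP => /(congr1 (coefL (alpha, i))) /eqP.
by rewrite coefL_basis eqxx coefL0 oner_eq0.
Qed.

Lemma coefL_neq0P x : x != 0 -> exists a, coefL a x != 0.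
Proof.
move=> x0; apply: boolp.contrapT => /boolp.forallNP a0.
case/eqP: x0; apply: coefLP => a; rewrite coefL0.
by apply/eqP; apply: boolp.contrapT => /negP/a0.
Qed.

(** With [P] a degree condition, identities on one eigenspace need checking only on its basis
    elements. *)
Lemma eq_linear_supp (V : lmodType F) (P : int * nat -> Prop) (f g : B -> V) :
    linear f -> linear g -> (forall a, P a -> f (L a.1 a.2) = g (L a.1 a.2)) ->
  forall x, (forall a, coefL a x != 0 -> P a) -> f x = g x.
Proof.
move=> fL gL eq_fg x xP.
pose f' := HB.pack_for {linear B -> V} f (GRing.isLinear.Build _ _ _ _ f fL).
pose g' := HB.pack_for {linear B -> V} g (GRing.isLinear.Build _ _ _ _ g gL).
rewrite -[f]/(f' : _ -> _) -[g]/(g' : _ -> _) [x]suppE.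
rewrite !(linear_sum f', linear_sum g') big_seq [RHS]big_seq.
apply: eq_bigr => a; rewrite mem_supp => a_x; rewrite !linearZ /=.
by congr (_ *: _); apply/eq_fg/xP.
Qed.

Lemma coefL_lie x y c : coefL c (lie x y) =
  \sum_(a <- supp x) \sum_(b <- supp y)
    coefL a x * coefL b y * (bracket_coef a b)%:~R
      * (c == (a.1 + b.1, (a.2 + b.2)%N))%:R.
Proof.
rewrite {1}[x]suppE lie_suml coefL_sum; apply: eq_bigr => a _.
rewrite lieZl coefLZ {1}[y]suppE linear_sum /= coefL_sum mulr_sumr.
apply: eq_bigr => b _; rewrite lieZr coefLZ lieLE !coefLZ coefL_basis.
by rewrite !mulrA.
Qed.

Lemma coefL_lie00 y b :
  coefL b (lie (L 0 0) y) = - (b.1 + b.2%:Z)%:~R * coefL b y.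
Proof.
apply: (@eq_linear_supp F^o (fun=> True) (fun y => coefL b (lie (L 0 0) y))
  (fun y => - (b.1 + b.2%:Z)%:~R * coefL b y)) => // [c u v|c u v|[beta j] _].
- by rewrite lie_linearr coefL_linear.
- by rewrite coefLD coefLZ mulrDr; congr (_ + _); exact: mulrCA.
rewrite lieLE coefLZ !coefL_basis !add0r add0n.
case: eqP => [->|_]; last by rewrite !mulr0.
by rewrite -rmorphN; congr (_%:~R * _); rewrite /bracket_coef /=; ring.
Qed.

(** * Leading exponents *)

Section LeadingTerm.
Variable s : int.
Hypothesis sE : s = 1 \/ s = -1.

Definition lead x a :=
  coefL a x != 0 /\ forall b, coefL b x != 0 -> lexle s b a.

Lemma lead_neq0 x a : lead x a -> x != 0.
Proof. by case=> xa _; apply: contraNneq xa => ->; rewrite coefL0. Qed.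

Lemma lead_L alpha i : lead (L alpha i) (alpha, i).
Proof.
split=> [|b]; rewrite coefL_basis ?eqxx ?oner_eq0 //.
by case: (b =P _) => [-> _ | _]; rewrite ?(lexle_refl sE) ?eqxx.
Qed.

Lemma lead_ex x b : coefL b x != 0 -> exists2 a, lead x a & lexle s b a.
Proof.
rewrite -mem_supp => /[dup] bx /(lexle_max sE)[a ax max_a].
exists a; last exact: max_a.
by split=> [|c]; rewrite -mem_supp //; apply: max_a.
Qed.

(** By [lexle_add_inj] the coefficient at [addk a b] is a single nonzero term; [lexle_add] bounds
    all other exponents. *)
Lemma lead_lie x y a b : lead x a -> lead y b ->
  (bracket_coef a b)%:~R != 0 :> F -> lead (lie x y) (addk a b).
Proof.
move=> [xa max_a] [yb max_b] ab0; split.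
  rewrite coefL_lie (big_rem a) ?mem_supp //= (big_rem b) ?mem_supp //=.
  rewrite eqxx mulr1 big1_seq ?addr0.
    rewrite big1_seq ?addr0 ?mulf_neq0 // => a' /andP[_].
    rewrite mem_rem_uniq ?supp_uniq // inE mem_supp => /andP[a'a xa'].
    rewrite big1_seq // => b' /andP[_]; rewrite mem_supp => yb'.
    case: eqP => [/esym/(lexle_add_inj sE (max_a _ xa') (max_b _ yb')) [] | _].
      by move/eqP; rewrite (negPf a'a).
    by rewrite mulr0.
  move=> b' /andP[_]; rewrite mem_rem_uniq ?supp_uniq // inE mem_supp.
  case/andP=> b'b yb'.
  case: eqP => [/esym/(lexle_add_inj sE (max_a _ xa) (max_b _ yb')) [] | _].
    by move=> _ /eqP; rewrite (negPf b'b).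
  by rewrite mulr0.
move=> c; apply: contra_neqT => nle_c.
rewrite coefL_lie big1_seq // => a' /andP[_]; rewrite mem_supp => xa'.
rewrite big1_seq // => b' /andP[_]; rewrite mem_supp => yb'.
case: eqP => [cE | _]; last by rewrite mulr0.
case/negP: nle_c; rewrite cE.
by apply: (lexle_add sE); [apply: max_a | apply: max_b].
Qed.

(** Since [a] is positive, [addk a b] lies above every exponent of [y], so subtracting [c *: y]
    cannot cancel the leading term. *)
Lemma lead_ad_sub x y c a b : lead x a -> lead y b -> a != (0, 0%N) ->
  lexle s (0, 0%N) a -> (bracket_coef a b)%:~R != 0 :> F ->
  lead (ad_sub x y c) (addk a b).
Proof.
move=> xa yb a0 a_ge0 ab0; have [cab max_ab] := lead_lie xa yb ab0.
have b_le : lexle s b (addk a b).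
  by move: a_ge0; rewrite /lexle /addk /=; case: sE => ->; lia.
have y0 : coefL (addk a b) y = 0.
  apply/eqP; apply: contraNT a0 => /(yb.2)/(lexle_anti sE b_le).
  by case: a b {xa yb a_ge0 ab0 cab max_ab b_le} => [a1 a2] [b1 b2] [];
     rewrite xpair_eqE /=; lia.
split=> [|d]; rewrite coefL_ad_sub.
  by rewrite y0 mulr0 subr0.
have [/yb.2 db _ | ] := boolP (coefL d y != 0).
  exact: (lexle_trans sE db b_le).
by rewrite negbK => /eqP->; rewrite mulr0 subr0 => /max_ab.
Qed.

(** After n operators the leading exponent is b + n a, whatever the scalars in [r]. *)
Lemma ad_subs_neq0 x y a b r : lead x a -> lead y b -> a != (0, 0%N) ->
  lexle s (0, 0%N) a ->
  (forall n, (bracket_coef a (b.1 + a.1 * n%:Z, (b.2 + a.2 * n)%N))%:~R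
     != 0 :> F) ->
  foldl (ad_sub x) y r != 0.
Proof.
move=> xa + a0 a_ge0.
elim: r y b => [|c r IHr] y b yb ab0 /=; first exact: lead_neq0 yb.
apply: (IHr _ (addk a b)) => [|n].
  apply: lead_ad_sub => //; have := ab0 0%N.
  by rewrite mulr0 addr0 muln0 addn0 -surjective_pairing.
have := ab0 n.+1; rewrite /addk /= -addn1 PoszD.
by congr (~~ ((bracket_coef _ (_, _))%:~R == _)); [ring | lia].
Qed.

End LeadingTerm.

(** * The image of [L 0 0] under an automorphism *)

Hypothesis charF0 : [pchar F] =i pred0.

Lemma intr_eq0_char0 (z : int) : (z%:~R == 0 :> F) = (z == 0).
Proof.
have natr0 := (GRing.pcharf0P F).1 charF0.
by case: z => n; rewrite ?NegzE ?mulrNz ?oppr_eq0 -pmulrn natr0.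
Qed.

(** The sign [s] is chosen to make [a] positive; the leading exponent of [x] dominates [a], hence is
    positive too. *)
Lemma ad_subs_neq0_ex (x : B) a : coefL a x != 0 -> a != (0, 0%N) ->
  exists y : B, forall r, foldl (ad_sub x) y r != 0.
Proof.
move=> xa a0.
have [s [sE a_ge0]] : exists s : int, (s = 1 \/ s = -1) /\ lexle s (0, 0%N) a.
  have [a_ge0 | a_lt0] := boolP (lexle 1 (0, 0%N) a).
    by exists 1; split=> //; left.
  by exists (-1); split; [right | move: a_lt0; rewrite /lexle; lia].
have [m xm am] := lead_ex sE xa.
have m_ge0 := lexle_trans sE a_ge0 am.
have m0 : m != (0, 0%N).
  apply: contraNneq a0 => m0; rewrite m0 in am.
  by rewrite (lexle_anti sE am a_ge0).
(* The coefficients of the successive leading terms are c - n (m.1 + m.2) for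
   n >= 0; beta makes c nonzero of sign opposite to m.1 + m.2. *)
pose beta : int := if (0 <= m.1 + m.2%:Z) then `|m.1| + 2 else - `|m.1| - 1.
exists (L beta 0) => r.
apply: (ad_subs_neq0 sE r xm (lead_L sE beta 0) m0 m_ge0) => n.
rewrite intr_eq0_char0 /bracket_coef /= /beta.
by case: ifP => m_sgn; nia.
Qed.

(** The preimage [z] of [y] is a finite sum of eigenvectors of ad [L 0 0], so the product over their
    eigenvalues kills it; applying [tau] contradicts the choice of [y]. *)
Lemma aut_zero_degree (tau : lie_aut B) a :
  a != (0, 0%N) -> coefL a (tau (L 0 0)) = 0.
Proof.
move=> a0; apply/eqP; apply: contraT => /ad_subs_neq0_ex/(_ a0)[y y_neq0].
pose z : B := lie_aut_inv tau y.
pose ev b : F := - (b.1 + b.2%:Z)%:~R.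
have coef_ad_subs r w b : coefL b (foldl (ad_sub (L 0 0)) w r) =
    (\prod_(c <- r) (ev b - c)) * coefL b w.
  elim: r w => [|c r IHr] w /=; first by rewrite big_nil mul1r.
  rewrite IHr coefL_ad_sub coefL_lie00 -/(ev b) -mulrBl big_cons.
  by rewrite mulrA [_ * (ev b - c)]mulrC.
have zr0 : foldl (ad_sub (L 0 0)) z [seq ev b | b <- supp z] = 0.
  apply: coefLP => b; rewrite coef_ad_subs coefL0.
  have [zb | ] := boolP (b \in supp z).
    by rewrite big_map (big_rem b) //= subrr !mul0r.
  by rewrite mem_supp negbK => /eqP->; rewrite mulr0.
case/eqP: (y_neq0 [seq ev b | b <- supp z]).
by rewrite -[y in foldl _ y](lie_aut_inv_funK tau) -ad_subs_aut zr0 linear0.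
Qed.

(** [L 1 0] has eigenvalue -1 under ad [L 0 0], so its image has eigenvalue -1 under ad
    [c *: L 0 0]; at any exponent b of the image this reads c (b.1 + b.2) = 1. *)
Lemma aut_zero_int (tau : lie_aut B) : exists (c : F) (z : int),
  tau (L 0 0) = c *: L 0 0 /\ c * z%:~R = 1.
Proof.
pose c := coefL (0, 0%N) (tau (L 0 0)).
have tau0 : tau (L 0 0) = c *: L 0 0.
  apply: coefLP => a; rewrite coefLZ coefL_basis.
  by case: eqVneq => [-> | /(aut_zero_degree tau)->]; rewrite ?mulr1 ?mulr0.
have /coefL_neq0P[b wb] : tau (L 1 0) != 0.
  apply: contraNneq (L_neq0 1 0) => w0.
  by apply/eqP/(bij_inj (lie_aut_bij tau)); rewrite w0 linear0.
exists c, (b.1 + b.2%:Z); split=> //.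
have := lie_aut_lie tau (L 0 0) (L 1 0).
rewrite lieLE tau0 lieZl add0r linearZ => /(congr1 (coefL b)).
rewrite !coefLZ coefL_lie00 mulrA => /(mulIf wb)/eqP.
by rewrite (_ : bracket_coef _ _ = -1) // rmorphN1 mulrN eqr_opp eq_sym => /eqP.
Qed.

(** The scalars of [tau] and of its inverse are mutually inverse, and each is the reciprocal of an
    integer; so [c] is the integer [z'], and [z' * z] is 1. *)
Lemma aut_zero (tau : lie_aut B) : exists xi : int,
  (xi = 1 \/ xi = -1) /\ tau (L 0 0) = xi%:~R *: L 0 0.
Proof.
have [c [z [tau0 cz]]] := aut_zero_int tau.
have [c' [z' [tau0' cz']]] := aut_zero_int (lie_aut_inv tau).
have c'c : c' * c = 1.
  have : lie_aut_inv tau (tau (L 0 0)) = L 0 0 by exact: lie_aut_funK.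
  rewrite tau0 lie_autZ tau0' scalerA => /(congr1 (coefL (0, 0%N))).
  by rewrite coefLZ coefL_basis eqxx mulr1 mulrC.
have c'0 : c' != 0.
  by apply: contra_eq_neq c'c => ->; rewrite mul0r eq_sym oner_eq0.
have cE : c = z'%:~R by apply: (mulfI c'0); rewrite c'c cz'.
exists z'; rewrite -cE; split=> //.
have /eqP : (z' * z - 1)%:~R = 0 :> F by rewrite intrB intrM -cE cz subrr.
rewrite intr_eq0_char0 subr_eq0 => /eqP/(congr1 absz)/eqP.
by rewrite abszM muln_eq1; lia.
Qed.

(** * Eigenspaces of ad [L 0 0] as spaces of polynomials *)

Definition homogeneous (k : int) (x : B) :=
  forall a, coefL a x != 0 -> a.1 + a.2%:Z = k.

(** Automorphisms fixing [L 0 0] preserve the bracket form; characteristic zero keeps the integer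
    eigenvalues distinct. *)
Lemma homogeneousP k x :
  homogeneous k x <-> lie (L 0 0) x = - k%:~R *: x.
Proof.
split=> [xk | xk a xa].
  apply: coefLP => a; rewrite coefL_lie00 coefLZ.
  have [/xk-> // | ] := boolP (coefL a x != 0).
  by rewrite negbK => /eqP->; rewrite !mulr0.
have /eqP := congr1 (coefL a) xk; rewrite coefL_lie00 coefLZ.
rewrite (inj_eq (mulIf xa)) eqr_opp -subr_eq0 -intrB intr_eq0_char0.
by rewrite subr_eq0 => /eqP.
Qed.

Lemma homogeneousL alpha i k : alpha + i%:Z = k -> homogeneous k (L alpha i).
Proof.
by move=> <- a; rewrite coefL_basis; case: (a =P _) => [-> | _]; rewrite ?eqxx.
Qed.

Lemma homogeneousZ k c x : homogeneous k x -> homogeneous k (c *: x).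
Proof.
move=> xk a; rewrite coefLZ => cxa; apply: xk.
by apply: contraNneq cxa => ->; rewrite mulr0.
Qed.

Lemma homogeneousD k x y :
  homogeneous k x -> homogeneous k y -> homogeneous k (x + y).
Proof.
move=> xk yk a; have [/xk // | ] := boolP (coefL a x != 0).
by rewrite negbK coefLD => /eqP->; rewrite add0r => /yk.
Qed.

Lemma coef_polyB k x a : homogeneous k x -> a.1 + a.2%:Z = k ->
  (polyB x)`_a.2 = coefL a x.
Proof.
move=> xk ak; apply: (eq_linear_supp (V := F^o) (f := fun x => (polyB x)`_a.2)
  (g := coefL a) _ _ _ xk) => [c u v||b bk].
- by rewrite linearP coefD coefZ.
- exact: coefL_linear.
rewrite polyBL coefXn coefL_basis; congr (nat_of_bool _)%:R.
apply/eqP/eqP => [ab|-> //]; rewrite [a in LHS]surjective_pairing.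
by congr (_, _); lia.
Qed.

(** [polyB] forgets the first index, but degree k recovers it from the second as alpha = k - i. *)
Lemma polyB_inj k x y :
  homogeneous k x -> homogeneous k y -> polyB x = polyB y -> x = y.
Proof.
move=> xk yk eq_xy; apply: coefLP => a.
have [ak | ak] := eqVneq (a.1 + a.2%:Z) k.
  by rewrite -(coef_polyB xk ak) -(coef_polyB yk ak) eq_xy.
have [/xk/eqP | ] := boolP (coefL a x != 0); first by rewrite (negPf ak).
have [/yk/eqP | ] := boolP (coefL a y != 0); first by rewrite (negPf ak).
by rewrite !negbK => /eqP-> /eqP->.
Qed.

(** On basis elements the bracket coefficient collapses to -k (i + 1), and (X X^i)' supplies the
    factor i + 1. *)
Lemma polyB_lie k x y : homogeneous 0 x -> homogeneous k y ->
  polyB (lie x y) = - k%:~R *: (('X * polyB x)^`() * polyB y).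
Proof.
move=> x0 yk; move: x x0.
apply: (eq_linear_supp (f := fun x => polyB (lie x y))
  (g := fun x => - k%:~R *: (('X * polyB x)^`() * polyB y)))
  => [c u v|c u v|a a0].
- by rewrite lie_linearl linearP.
- rewrite linearP mulrDr -scalerAr linearP mulrDl -scalerAl scalerDr !scalerA.
  by rewrite mulrC.
move: y yk; apply: (eq_linear_supp (f := fun y => polyB (lie (L a.1 a.2) y))
  (g := fun y => - k%:~R *: (_ * polyB y))) => [c u v|c u v|b bk].
- by rewrite !linearP.
- by rewrite linearP mulrDr -scalerAr scalerDr !scalerA mulrC.
rewrite lieLE linearZ /= !polyBL -exprS derivXn /= mulrnAl -exprD -scaler_nat.
rewrite scalerA pmulrn -rmorphN -rmorphM; congr (_%:~R *: _).
by rewrite /bracket_coef -bk /=; lia.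
Qed.

(** * Automorphisms fixing L_{0,0} *)

Section FixedZero.
Variable tau : lie_aut B.
Hypothesis tau0 : tau (L 0 0) = L 0 0.

Lemma tau_homogeneous k x : homogeneous k x -> homogeneous k (tau x).
Proof.
move=> /homogeneousP xk; apply/homogeneousP.
by have := lie_aut_lie tau (L 0 0) x; rewrite tau0 xk lie_autZ; exact: esym.
Qed.

Lemma tau_homogeneousV k y : homogeneous k y ->
  exists2 x, homogeneous k x & tau x = y.
Proof.
have [g tauK gK] := lie_aut_bij tau.
move=> /homogeneousP yk; exists (g y) => //.
apply/homogeneousP/(can_inj tauK).
by rewrite lie_aut_lie tau0 lie_autZ gK.
Qed.

Lemma natr_neq0 n : n.+1%:R != 0 :> F.
Proof. by rewrite ((GRing.pcharf0P F).1 charF0). Qed.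

(** The factor 1/2 is a normalization: if [tau] is the identity, the derivative is (X^2)' = 2 X and
    this polynomial is X. *)
Definition subst_poly : {poly F} :=
  locked (2^-1 *: ('X * polyB (tau (L (-1) 1)))^`()).
Local Notation r := subst_poly.

Lemma deriv_subst_poly : ('X * polyB (tau (L (-1) 1)))^`() = 2 *: r.
Proof.
by rewrite /subst_poly -lock scalerA mulfV ?scale1r //; exact: natr_neq0.
Qed.

(** Bracketing with [L (-1) 1] raises i by one with coefficient -2 k; on the images it multiplies by
    -2 k [r]. As k is nonzero, -2 k cancels. *)
Lemma polyB_tauL k i : k != 0 ->
  polyB (tau (L (k - i%:Z) i)) = r ^+ i * polyB (tau (L k 0)).
Proof.
move=> k0; elim: i => [|i IHi]; first by rewrite subr0 mul1r.
have := lie_aut_lie tau (L (-1) 1) (L (k - i%:Z) i).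
have -> : lie (L (-1) 1) (L (k - i%:Z) i) =
    (k * - 2)%:~R *: L (k - i.+1%:Z) i.+1.
  by apply: lieL_eq; rewrite /bracket_coef /=; lia.
rewrite lie_autZ => /(congr1 polyB); rewrite linearZ /=.
rewrite (polyB_lie (k := k)); first last.
- by apply/tau_homogeneous/homogeneousL; lia.
- by apply/tau_homogeneous/homogeneousL.
rewrite IHi deriv_subst_poly -scalerAl scalerA mulrA -exprS.
have -> : - k%:~R * 2 = (k * - 2)%:~R :> F by rewrite intrM mulrN mulNr.
by apply: scalerI; rewrite intr_eq0_char0; lia.
Qed.

Lemma polyB_tau k x : k != 0 -> homogeneous k x ->
  polyB (tau x) = (polyB x \Po r) * polyB (tau (L k 0)).
Proof.
move=> k0; apply: (eq_linear_supp (f := fun x => polyB (tau x))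
  (g := fun x => (polyB x \Po r) * polyB (tau (L k 0)))) => [c u v|c u v|a ak].
- by rewrite !linearP.
- by rewrite !linearP mulrDl -scalerAl.
have -> : a.1 = k - a.2%:Z by lia.
by rewrite polyB_tauL // polyBL comp_Xn_poly.
Qed.

(** For nonzero k, [L k 0] has polynomial 1 and is the image of an element of degree k, so
    [polyB (tau (L k 0))] divides 1. *)
Lemma tau_scalar k : exists2 c, c != 0 & tau (L k 0) = c *: L k 0.
Proof.
have [-> | k0] := eqVneq k 0.
  by exists 1; [exact: oner_neq0 | rewrite tau0 scale1r].
have Lk : homogeneous k (L k 0) by apply: homogeneousL; lia.
have [x xk tau_x] := tau_homogeneousV Lk.
have := polyB_tau k0 xk; rewrite tau_x polyBL => eq1.
have : polyB (tau (L k 0)) %| 1 by rewrite -[1]/('X^0) eq1 dvdp_mull.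
rewrite dvdp1 => /size_poly1P[c c0 cE]; exists c => //.
apply: (polyB_inj (tau_homogeneous Lk)); first exact: homogeneousZ.
by rewrite cE linearZ_LR polyBL alg_polyC.
Qed.

(** The polynomial X of [L 0 1] is attained in degree 1, so some composite with [r] has degree 1,
    which forces [r] to have degree 1. *)
Lemma size_subst_poly : size r = 2.
Proof.
have L1 : homogeneous 1 (L 0 1) by apply: homogeneousL.
have [x xk tau_x] := tau_homogeneousV L1.
have := polyB_tau (isT : (1 : int) != 0) xk; rewrite tau_x polyBL.
have [c c0 ->] := tau_scalar 1.
rewrite linearZ_LR polyBL -scalerAr mulr1.
move/(congr1 (fun p : {poly F} => size p)).
rewrite size_scale // size_polyX => sz2.
have := size_comp_poly (polyB x) r; rewrite -sz2 /= => /esym/eqP.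
by rewrite muln_eq1; case/andP=> _; case: (size r) => [|[|[|]]].
Qed.

Definition tau_coef k : F := s2val (boolp.cid2 (tau_scalar k)).
Local Notation C := tau_coef.

Lemma tau_coef_neq0 k : C k != 0.
Proof. exact: (s2valP (boolp.cid2 (tau_scalar k))). Qed.

Lemma tau_coefE k : tau (L k 0) = C k *: L k 0.
Proof. exact: (s2valP' (boolp.cid2 (tau_scalar k))). Qed.

Lemma tau_coef0 : C 0 = 1.
Proof.
by have := tau_coefE 0; rewrite tau0 -[LHS]scale1r => /scaleL_inj.
Qed.

Lemma tau_coefD k l : k != l -> C (k + l) = C k * C l.
Proof.
move=> kl; have lie_kl : lie (L k 0) (L l 0) = (k - l)%:~R *: L (k + l) 0.
  by apply: lieL_eq; rewrite /bracket_coef /=; lia.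
have := lie_aut_lie tau (L k 0) (L l 0).
rewrite lie_kl lie_autZ !tau_coefE lieZl lieZr lie_kl !scalerA => /scaleL_inj.
rewrite [RHS]mulrC; apply: mulfI.
by rewrite intr_eq0_char0 subr_eq0.
Qed.

Lemma tau_coef_exp k : C k = C 1 ^ k.
Proof. exact: exprz_of_morph tau_coef0 tau_coef_neq0 tau_coefD k. Qed.

(** Applying [tau] to [L_{1,0}, L_{-2,1}] = 3 L_{-1,1} and reading the coefficient of L_{0,0} gives
    6 b = 2 b for the constant term b of [r]. *)
Lemma subst_poly0 : r`_0 = 0.
Proof.
have Cm1 : C 1 * C (-1) = 1 by rewrite -tau_coefD // addrN tau_coef0.
have Lm1 : homogeneous (-1) (L (-2) 1) by apply: homogeneousL.
have tauLm1 : tau (L (-2) 1) = C (-1) *: (r`_1 *: L (-2) 1 + r`_0 *: L (-1) 0).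
  apply: (polyB_inj (tau_homogeneous Lm1)).
    apply/homogeneousZ/homogeneousD; apply/homogeneousZ => //.
    exact: homogeneousL.
  rewrite (polyB_tau (k := -1)) // polyBL comp_polyX tau_coefE.
  rewrite !linearZ_LR linearD !linearZ_LR !polyBL.
  rewrite -scalerAr mulr1; congr (_ *: _).
  apply/polyP => -[|[|i]]; rewrite !(coefD, coefZ, coefXn) /=;
    rewrite ?mulr0 ?mulr1 ?add0r ?addr0 //.
  by rewrite nth_default ?size_subst_poly.
have lie3 : lie (L 1 0) (L (-2) 1) = 3 *: L (-1) 1.
  by apply: (@lieL_eq _ _ _ _ _ _ 3).
have lie2 : lie (L 1 0) (L (-1) 0) = 2 *: L 0 0.
  by apply: (@lieL_eq _ _ _ _ _ _ 2).
have := lie_aut_lie tau (L 1 0) (L (-2) 1).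
rewrite lie3 lie_autZ tauLm1 tau_coefE lieZl lieZr linearD /= !lieZr lie3 lie2.
rewrite scalerA Cm1 scale1r => /(congr1 (coefL (0, 0%N))).
rewrite coefLD !coefLZ !coefL_basis /= !mulr0 add0r mulr1.
have h0 : homogeneous 0 (tau (L (-1) 1)).
  by apply/tau_homogeneous/homogeneousL.
rewrite -(coef_polyB h0 (a := (0, 0%N))) //=.
(* The constant term of (X p)' is that of p, so the coefficient sought is 2 b. *)
have /(congr1 (fun p : {poly F} => p`_0)) := deriv_subst_poly.
rewrite coef_deriv coefXM mulr1n coefZ => ->.
move/eqP; rewrite -subr_eq0 (_ : _ - _ = 4 * r`_0); last by ring.
by rewrite mulf_eq0 (negPf (natr_neq0 3)) => /eqP.
Qed.

Lemma subst_polyE : r = r`_1 *: 'X.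
Proof.
apply/polyP => -[|[|i]]; rewrite coefZ coefX ?mulr1 ?mulr0 ?subst_poly0 //.
by rewrite nth_default ?size_subst_poly.
Qed.

Lemma subst_poly1_neq0 : r`_1 != 0.
Proof.
apply: contra_eq_neq size_subst_poly => r1.
by rewrite subst_polyE r1 scale0r size_poly0.
Qed.

Lemma tauL_nz k i : k != 0 ->
  tau (L (k - i%:Z) i) = (C k * r`_1 ^+ i) *: L (k - i%:Z) i.
Proof.
move=> k0; have Lk : homogeneous k (L (k - i%:Z) i) by apply: homogeneousL; lia.
apply: (polyB_inj (tau_homogeneous Lk)); first exact: homogeneousZ.
rewrite polyB_tauL // tau_coefE !(linearZ_LR, polyBL) -scalerAr mulr1.
by rewrite [in LHS]subst_polyE exprZn scalerA.
Qed.

Lemma tauL alpha i :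
  tau (L alpha i) = (C 1 ^ (alpha + i%:Z) * r`_1 ^+ i) *: L alpha i.
Proof.
rewrite -tau_coef_exp.
have [k0 | k0] := eqVneq (alpha + i%:Z) 0; last first.
  by have := tauL_nz i k0; rewrite addrK.
rewrite k0 tau_coef0 mul1r.
(* Degree 0, which [tauL_nz] excludes, is reached by bracketing degrees 1 and -1, with coefficient i
   + 2. *)
pose c : int := i.+2%:Z.
have c0 : c%:~R != 0 :> F by rewrite intr_eq0_char0.
have lieE : lie (L 1 0) (L (-1 - i%:Z) i) = c%:~R *: L alpha i.
  by apply: lieL_eq; rewrite /bracket_coef /= /c; lia.
apply: (scalerI c0); rewrite -lie_autZ -lieE lie_aut_lie tauL_nz // tau_coefE.
rewrite lieZl lieZr lieE !scalerA; congr (_ *: _).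
have Cm1 : C 1 * C (-1) = 1 by rewrite -tau_coefD // addrN tau_coef0.
by rewrite mulrA Cm1 mul1r mulrC.
Qed.

Lemma fixed_zero_form : exists mu nu : F, [/\ mu != 0, nu != 0 &
  forall alpha i, tau (L alpha i) = (mu ^ alpha * nu ^+ i) *: L alpha i].
Proof.
(* These come from C(1)^(alpha + i) r_1^i = C(1)^alpha (C(1) r_1)^i. *)
exists (C 1), (C 1 * r`_1); split; first exact: tau_coef_neq0.
  by rewrite mulf_neq0 ?tau_coef_neq0 ?subst_poly1_neq0.
move=> alpha i; rewrite tauL expfzDr ?tau_coef_neq0 // exprMn mulrA.
by rewrite exprnP.
Qed.

End FixedZero.
End BlockBasis.

Lemma mulg_swap (G : groupType) (a b c d e : G) :
  (b * c = c * d -> a * b * (c * e) = a * c * (d * e))%g.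
Proof. by move=> eq_bc; rewrite !mulgA -[(a * b * c)%g]mulgA eq_bc !mulgA. Qed.

(** * The automorphism group of B *)

Section BlockB.
Variable F : fieldType.
Local Notation B := (blockB F).
Local Notation L := (@basisL F).
Implicit Types (x : B) (k h : 'Z_2).

Lemma comp_basisL (f g : lie_aut B) c d alpha beta gamma i :
    f (L beta i) = d *: L gamma i -> g (L alpha i) = c *: L beta i ->
  (f * g)%g (L alpha i) = (c * d) *: L gamma i.
Proof.
move=> fL gL; rewrite lie_aut_mulE gL.
by apply: etrans (lie_autZ f c _) _; rewrite fL; exact: scalerA.
Qed.

Lemma scale_basisL_eq c d alpha beta i :
  c = d -> alpha = beta -> c *: L alpha i = d *: L beta i.
Proof. by move=> -> ->. Qed.

Lemma monomial_autP (f g : lie_aut B) (c d : int -> nat -> F)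
    (s t : int -> nat -> int) :
    (forall alpha i, f (L alpha i) = c alpha i *: L (s alpha i) i) ->
    (forall alpha i, g (L alpha i) = d alpha i *: L (t alpha i) i) ->
    (forall alpha i, c alpha i = d alpha i) ->
    (forall alpha i, s alpha i = t alpha i) ->
  f = g.
Proof.
move=> fL gL cd st; apply: lie_aut_basisP => alpha i.
apply: etrans (fL _ _) (etrans _ (esym (gL _ _))).
exact: scale_basisL_eq (cd _ _) (st _ _).
Qed.

Lemma scale_basisL_inj alpha i : injective (fun c => c *: L alpha i).
Proof.
apply: (can_inj (g := mcoeff (alpha, i))) => c.
exact: etrans (mcoeffZ _ _ _) (etrans (congr1 _ (mcoeffUU _ _)) (mulr1 _)).
Qed.

(** * The abstract hypotheses for [blockB] *)

Fact block_lieL alpha i beta j : lie (L alpha i) (L beta j) =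
  (bracket_coef (alpha, i) (beta, j))%:~R *: L (alpha + beta) (i + j)%N.
Proof. exact: lieL. Qed.

Definition block_supp x : seq (int * nat) := msupp x.

Fact block_supp_uniq x : uniq (block_supp x).
Proof. exact: fset_uniq. Qed.

Fact mem_block_supp (a : int * nat) x :
  (a \in block_supp x) = (mcoeff a x != 0).
Proof. by rewrite mcoeff_neq0. Qed.

Fact block_suppE x : x = \sum_(a <- block_supp x) mcoeff a x *: L a.1 a.2.
Proof.
apply: etrans (malg_lin_ext x) _.
by apply: eq_bigr => -[alpha i] _.
Qed.

Fact block_mcoeff_linear a : linear (mcoeff a : B -> F^o).
Proof. by move=> c x y; rewrite mcoeffD mcoeffZ. Qed.

Fact block_mcoeffL alpha i b : mcoeff b (L alpha i) = (b == (alpha, i))%:R.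
Proof. by rewrite mcoeffU eq_sym. Qed.

Definition block_poly : {linear B -> {poly F}} :=
  HB.pack_for {linear B -> {poly F}} (lin_ext (fun a => 'X^(a.2)))
    (GRing.isLinear.Build _ _ _ _ _
      (lin_ext_linear (fun a : int * nat => 'X^(a.2)))).

Fact block_polyL alpha i : block_poly (L alpha i) = 'X^i.
Proof. exact: lin_extU. Qed.

(** * The torus, the sign involution and their exchange relation *)

Lemma Z2P k : k = 0 \/ k = 1.
Proof. by case: k => [[|[|]]] // ?; [left | right]; apply: val_inj. Qed.

Lemma sign2_sq k : sign2 k * sign2 k = 1.
Proof. by case: (sign2P k) => ->. Qed.

Lemma rhoM h k : rho (h * k)%g = (rho h * rho k)%g :> lie_aut B.
Proof.
have hk : sign2 (h * k)%g = sign2 h * sign2 k.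
  by case: (Z2P h) (Z2P k) => -> [] ->.
apply: (monomial_autP (@rhoL F (h * k)%g)
  (fun alpha i => comp_basisL (@rhoL F h _ i) (@rhoL F k alpha i))) => alpha i.
  by rewrite hk intrM mulrC.
by rewrite hk; ring.
Qed.

Lemma rho_sq k : (rho k * rho k = 1 :> lie_aut B)%g.
Proof.
(* The group law of ['Z_2] is addition, with unit the residue 0, whose sign is 1. *)
rewrite -rhoM (_ : (k * k)%g = 0); last by case: (Z2P k) => ->; apply: val_inj.
apply: lie_aut_basisP => alpha i; apply: (etrans (rhoL _ 0 alpha i)).
by rewrite (_ : sign2 0 = 1) // scale1r mul1r addrK.
Qed.

Definition torus (n : fstar F * fstar F) : lie_aut B := (phi n.1 * phi' n.2)%g.

Lemma torusL n alpha i : torus n (L alpha i) =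
  ((n.1 : F) ^ alpha * (n.2 : F) ^+ i) *: L alpha i.
Proof.
apply: (etrans (comp_basisL (phiL n.1 alpha i) (phi'L n.2 alpha i))).
by apply: scale_basisL_eq; rewrite // mulrC.
Qed.

Lemma torusM : {morph torus : m n / (m * n)%g}.
Proof.
move=> m n; apply: (monomial_autP (@torusL (m * n)%g)
  (fun alpha i => comp_basisL (torusL m alpha i) (torusL n alpha i)))
  => // alpha i /=.
by rewrite expfzMl exprMn mulrACA [RHS]mulrC.
Qed.

(* Conjugation by rho turns mu^alpha nu^i into
   mu^(-alpha - 2 i) nu^i = (mu^-1)^alpha (mu^-2 nu)^i. *)
Definition torus_act k (n : fstar F * fstar F) : fstar F * fstar F :=
  if k == 0 then n else (n.1^-1, n.1^-1 * n.1^-1 * n.2)%g.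

(** Free of inverses, this gives the conjugation formula and also the rule for moving [rho] to the
    right of the torus. *)
Lemma torus_rho k n :
  (torus (torus_act k n) * rho k)%g = (rho k * torus n)%g.
Proof.
apply: (monomial_autP
  (fun alpha i => comp_basisL (torusL (torus_act k n) _ i) (@rhoL F k alpha i))
  (fun alpha i => comp_basisL (@rhoL F k alpha i) (torusL n alpha i)))
  => // alpha i /=.
rewrite mulrC; congr (_ * _).
case: n => [[m m0] [n n0]]; case: (Z2P k) => -> /=.
  by rewrite (_ : sign2 0 = 1) // mul1r addrK.
have mVi : m^-1 ^+ i = m ^ (- i%:Z) by rewrite GRing.exprVn exprnN.
rewrite (_ : sign2 1 = -1) // exprz_inv !exprMn !mVi !mulrA -!expfzDr //.
by congr (_ ^ _ * _); ring.
Qed.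

Fact torus_act1 n : torus_act 1%g n = n. Proof. by []. Qed.

Fact torus_actM h k n : torus_act (h * k)%g n = torus_act h (torus_act k n).
Proof.
case: n => m n; case: (Z2P h) (Z2P k) => -> [] -> //=.
by rewrite /torus_act /= invgK !mulgA mulgK mulgV mul1g.
Qed.

Fact torus_act_morph k : {morph torus_act k : m n / (m * n)%g}.
Proof.
move=> [m1 m2] [n1 n2]; case: (Z2P k) => -> //=.
rewrite /torus_act /=; congr (_, _); apply: val_inj => /=.
  by rewrite invfM.
by rewrite !invfM; ring.
Qed.

Definition torus_autact := AutAction torus_act1 torus_actM torus_act_morph.

(** The torus factor stands on the left to match [sd_mul], where the first ['Z_2] component acts on
    the second torus component. *)
Definition normal_form (x : semidirect torus_autact) : lie_aut B :=
  (torus (sd_pair x).1 * rho (sd_pair x).2)%g.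

Lemma normal_formM : {morph normal_form : x y / (x * y)%g}.
Proof.
move=> [[n h]] [[m k]]; rewrite /normal_form /= torusM rhoM.
exact/mulg_swap/torus_rho.
Qed.

Lemma normal_formL n k alpha i :
  normal_form (sd_elt torus_autact n k) (L alpha i) =
    ((sign2 k)%:~R * ((n.1 : F) ^ (sign2 k * (alpha + i%:Z) - i%:Z)
      * (n.2 : F) ^+ i)) *: L (sign2 k * (alpha + i%:Z) - i%:Z) i.
Proof. exact: comp_basisL (torusL _ _ i) (@rhoL F _ alpha i). Qed.

(** * Existence and uniqueness of the normal form *)

Section CharZero.
Hypothesis charF0 : [pchar F] =i pred0.

(** The coefficient at [L 0 0] is the sign, which determines the ['Z_2] component; after cancelling
    [rho], the values at [L 1 0] and [L 0 1] give the torus parameters. *)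
Lemma normal_form_inj : injective normal_form.
Proof.
move=> [[n h]] [[m k]] eq_nm.
have hk : h = k.
  have : ((sign2 h)%:~R : F) = (sign2 k)%:~R.
    apply: (@scale_basisL_inj 0 0).
    have := congr1 (fun f : lie_aut B => f (L 0 0)) eq_nm.
    have L00 (l : 'Z_2) p : normal_form (sd_elt torus_autact p l) (L 0 0) =
        (sign2 l)%:~R *: L 0 0.
      apply: (etrans (normal_formL p l 0 0)).
      have deg0 : sign2 l * (0 + 0%:Z) - 0%:Z = 0 by ring.
      apply: (scale_basisL_eq _ _ deg0).
      by rewrite deg0 expr0z expr0 !mulr1.
    by move=> eq0; exact: etrans (esym (L00 h n)) (etrans eq0 (L00 k m)).
  move/eqP; rewrite -subr_eq0 -intrB (intr_eq0_char0 charF0).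
  by case: (Z2P h) (Z2P k) => -> [] ->.
rewrite hk in eq_nm *; have torus_eq : torus n = torus m by exact: mulIg eq_nm.
have val_eq alpha i :
    (n.1 : F) ^ alpha * (n.2 : F) ^+ i = (m.1 : F) ^ alpha * (m.2 : F) ^+ i.
  apply: (@scale_basisL_inj alpha i).
  apply: etrans (esym (torusL n alpha i)) (etrans _ (torusL m alpha i)).
  by rewrite torus_eq.
case: n m {eq_nm torus_eq} val_eq => [n1 n2] [m1 m2] val_eq.
have -> : n1 = m1 by apply: val_inj; have := val_eq 1 0; rewrite !mulr1.
have -> // : n2 = m2.
by apply: val_inj; have := val_eq 0 1; rewrite !expr0z !mul1r.
Qed.

(** Composing with [rho k], for the sign found by [aut_zero], makes [L 0 0] fixed and the composite
    a torus element; [rho k] is its own inverse. *)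
Lemma block_aut_form (tau : lie_aut B) :
  exists (n : fstar F * fstar F) k, tau = (rho k * torus n)%g.
Proof.
have [xi [xi1 tau0]] := @aut_zero F B L block_supp (fun a x => mcoeff a x)
  block_lieL block_mcoeff_linear block_supp_uniq mem_block_supp block_suppE
  block_mcoeffL charF0 tau.
have [k kE] : exists k : 'Z_2, sign2 k = xi.
  by case: xi1 => ->; [exists 0 | exists 1].
pose sigma : lie_aut B := (rho k * tau)%g.
have sigma0 : sigma (L 0 0) = L 0 0.
  apply: etrans (comp_basisL (@rhoL F k 0 0) tau0) _.
  rewrite -[RHS]scale1r; apply: scale_basisL_eq; last by rewrite addr0 mulr0.
  by rewrite -intrM -kE sign2_sq.
have [mu [nu [mu0 nu0 sigmaL]]] := @fixed_zero_form F B L block_supp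
  (fun a x => mcoeff a x) block_poly block_lieL block_mcoeff_linear
  block_supp_uniq mem_block_supp block_suppE block_mcoeffL block_polyL charF0
  sigma sigma0.
exists (Fstar mu0, Fstar nu0), k.
have -> : torus (Fstar mu0, Fstar nu0) = sigma.
  by apply: (monomial_autP (torusL (Fstar mu0, Fstar nu0)) sigmaL).
by rewrite /sigma mulgA rho_sq mul1g.
Qed.

Lemma normal_form_bij : bijective normal_form.
Proof.
have normal_form_surj tau : exists y, normal_form y = tau.
  have [n [k ->]] := block_aut_form tau.
  (* [block_aut_form] has [rho] on the left; moving it to the right turns [n] into
     [torus_act k n]. *)
  by exists (sd_elt torus_autact (torus_act k n) k); exact: torus_rho.
pose g tau := projT1 (boolp.cid (normal_form_surj tau)).
have gK : cancel g normal_form.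
  by move=> tau; exact: (projT2 (boolp.cid (normal_form_surj tau))).
by exists g => // y; apply: normal_form_inj; rewrite gK.
Qed.

End CharZero.

Lemma phi1 : phi (1%g : fstar F) = 1%g.
Proof.
apply: lie_aut_basisP => alpha i; apply: (etrans (phiL _ alpha i)).
by rewrite /= exp1rz scale1r.
Qed.

Lemma phi'1 : phi' (1%g : fstar F) = 1%g.
Proof.
apply: lie_aut_basisP => alpha i; apply: (etrans (phi'L _ alpha i)).
by rewrite /= expr1n scale1r.
Qed.

Lemma rho0 : rho 1%g = 1%g :> lie_aut B.
Proof. by apply: (@mulgI _ (rho 1%g)); rewrite -rhoM !mulg1. Qed.

End BlockB.

Theorem theorem3p6 (F : closedFieldType) (charF0 : [pchar F] =i pred0) :
  (forall tau : lie_aut (blockB F),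
    exists mu nu : F, exists xi : int,
      [/\ mu != 0, nu != 0, xi = 1 \/ xi = -1 &
          forall (alpha : int) (i : nat),
            tau (basisL alpha i) =
              (xi%:~R * mu ^ alpha * nu ^+ i)
                *: basisL (xi * (alpha + i%:Z) - i%:Z) i]) /\
  (exists theta : group_autact (fstar F * fstar F)%type 'Z_2,
    (forall (k : 'Z_2) (mu nu : fstar F),
       (phi (theta k (mu, nu)).1 * phi' (theta k (mu, nu)).2 =
        rho k * (phi mu * phi' nu) * (rho k)^-1)%g) /\
    exists Phi : semidirect theta -> lie_aut (blockB F),
      [/\ bijective Phi,
          {morph Phi : x y / (x * y)%g},
          forall mu : fstar F, Phi (sd_elt theta (mu, 1%g) 1%g) = phi mu,
          forall nu : fstar F, Phi (sd_elt theta (1%g, nu) 1%g) = phi' nu &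
          forall k : 'Z_2, Phi (sd_elt theta 1%g k) = rho k]).
Proof.
split.
  (* With [rho] applied after the torus, the exponent of mu is alpha itself; in [normal_form] it
     would be twisted by the sign. *)
  move=> tau; have [[mu nu] [k ->]] := block_aut_form charF0 tau.
  exists (fstar_val mu), (fstar_val nu), (sign2 k).
  split; [exact: fstar_neq0 | exact: fstar_neq0 | exact: sign2P | ].
  move=> alpha i.
  apply: etrans (comp_basisL (@rhoL F k alpha i) (torusL (mu, nu) alpha i)) _.
  by apply: scale_basisL_eq; rewrite //= mulrC mulrA.
exists (torus_autact F); split.
  by move=> k mu nu; rewrite -[LHS]/(torus _) -(torus_rho k (mu, nu)) mulgK.
exists (@normal_form F); split.
- exact: normal_form_bij.
- exact: normal_formM.
- by move=> mu; rewrite /normal_form /torus /= phi'1 rho0 !mulg1.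
- by move=> nu; rewrite /normal_form /torus /= phi1 rho0 mulg1 mul1g.
- by move=> k; rewrite /normal_form /torus /= phi1 phi'1 !mul1g.
Qed.
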